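(* Let $G=(V,E)$, $J_{x,y}$, $h_x$, $\tilde h_x$, the transition matrix $P^{\mathrm{SCA}}_{\beta,\boldsymbol q}$, the mixing time $t^{\mathrm{SCA}}_{\mathrm{mix}}(\varepsilon)$, the disagreement set $D_{\boldsymbol\sigma,\boldsymbol\tau}$ and the transportation metric $\rho_{\mathrm{TM}}$ be as defined in the context. Let $\boldsymbol q=\{q_x\}_{x\in V}$ be any collection of non-negative real numbers, and let $\beta\ge 0$ be such that $$r:=\max_{x\in V}\left(\tanh\frac{\beta q_x}{2}+\sum_{y\in V}\tanh\frac{\beta |J_{x,y}|}{2}\right)<1$$ (a condition that does not involve $\{h_x\}_{x\in V}$). Then $$\rho_{\mathrm{TM}}\big(P^{\mathrm{SCA}}_{\beta,\boldsymbol q}(\boldsymbol\sigma,\cdot),P^{\mathrm{SCA}}_{\beta,\boldsymbol q}(\boldsymbol\tau,\cdot)\big)\le r\,|D_{\boldsymbol\sigma,\boldsymbol\tau}|\qquad\text{for all }\boldsymbol\sigma,\boldsymbol\tau\in\Omega,$$ and consequently, if $r>0$, for every $\varepsilon\in(0,1]$, $$t^{\mathrm{SCA}}_{\mathrm{mix}}(\varepsilon)\le\left\lceil\frac{\log|V|-\log\varepsilon}{\log(1/r)}\right\rceil .$$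
   Context: $G=(V,E)$ is a finite graph with nonempty vertex set and no multi- or self-edges. $\{J_{x,y}\}_{x,y\in V}$ are real spin-spin coupling constants with $J_{x,y}=J_{y,x}$ for all $x,y$ and $J_{x,y}=0$ whenever $\{x,y\}\notin E$ (in particular $J_{x,x}=0$). $\{h_x\}_{x\in V}$ are real external fields. The configuration space is $\Omega=\{\pm1\}^V$, with elements $\boldsymbol\sigma=\{\sigma_x\}_{x\in V}$. The cavity fields are $$\tilde h_x(\boldsymbol\sigma)=\sum_{y\in V}J_{x,y}\sigma_y+h_x .$$ For a collection of pinning parameters $\boldsymbol q=\{q_x\}_{x\in V}$, set $$\tilde H(\boldsymbol\sigma,\boldsymbol\tau)=-\frac12\sum_{x,y\in V}J_{x,y}\sigma_x\tau_y-\frac12\sum_{x\in V}h_x(\sigma_x+\tau_x)-\frac12\sum_{x\in V}q_x\sigma_x\tau_x ,$$ and, for inverse temperature $\beta\ge0$, $w^{\mathrm{SCA}}_{\beta,\boldsymbol q}(\boldsymbol\sigma)=\sum_{\boldsymbol\tau\in\Omega}e^{-\beta\tilde H(\boldsymbol\sigma,\boldsymbol\tau)}$. The stochastic cellular automaton (SCA) is the time-homogeneous Markov chain on $\Omega$ with transition matrix $$P^{\mathrm{SCA}}_{\beta,\boldsymbol q}(\boldsymbol\sigma,\boldsymbol\tau)=\frac{e^{-\beta\tilde H(\boldsymbol\sigma,\boldsymbol\tau)}}{w^{\mathrm{SCA}}_{\beta,\boldsymbol q}(\boldsymbol\sigma)}=\prod_{x\in V}\frac{e^{\frac\beta2(\tilde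 h_x(\boldsymbol\sigma)+q_x\sigma_x)\tau_x}}{2\cosh\big(\frac\beta2(\tilde h_x(\boldsymbol\sigma)+q_x\sigma_x)\big)} ,$$ which is reversible with respect to its equilibrium distribution $$\pi^{\mathrm{SCA}}_{\beta,\boldsymbol q}(\boldsymbol\sigma)=\frac{w^{\mathrm{SCA}}_{\beta,\boldsymbol q}(\boldsymbol\sigma)}{\sum_{\boldsymbol\tau\in\Omega}w^{\mathrm{SCA}}_{\beta,\boldsymbol q}(\boldsymbol\tau)} .$$ The total-variation distance of probability measures on $\Omega$ is $\|\mu-\nu\|_{\mathrm{TV}}=\frac12\sum_{\boldsymbol\sigma\in\Omega}|\mu(\boldsymbol\sigma)-\nu(\boldsymbol\sigma)|$. With $P=P^{\mathrm{SCA}}_{\beta,\boldsymbol q}$ and $\pi=\pi^{\mathrm{SCA}}_{\beta,\boldsymbol q}$, the mixing time is $$t^{\mathrm{SCA}}_{\mathrm{mix}}(\varepsilon)=\inf\Big\{t\in\{0,1,2,\dots\}:\max_{\boldsymbol\sigma\in\Omega}\|P^t(\boldsymbol\sigma,\cdot)-\pi\|_{\mathrm{TV}}\le\varepsilon\Big\}.$$ For $\boldsymbol\sigma,\boldsymbol\tau\in\Omega$, $D_{\boldsymbol\sigma,\boldsymbol\tau}=\{x\in V:\sigma_x\ne\tau_x\}$. The transportation metric between two probability measures $\mu,\nu$ on $\Omega$ is $$\rho_{\mathrm{TM}}(\mu,\nu)=\inf\big\{\mathbf E_{\mu,\nu}[|D_{X,Y}|]:(X,Y)\text{ is a coupling of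 }\mu\text{ and }\nu\big\},$$ where a coupling is a pair of $\Omega$-valued random variables on a common probability space with $X$ distributed as $\mu$ and $Y$ as $\nu$, and $\mathbf E_{\mu,\nu}$ is the corresponding expectation. *)

(* Defs.v *)
From HB Require Import structures.
From mathcomp Require Import all_boot all_order all_algebra.
From mathcomp Require Import all_classical all_reals all_analysis.

Set Implicit Arguments.
Unset Strict Implicit.
Unset Printing Implicit Defensive.

Import Order.TTheory GRing.Theory Num.Theory.
Import numFieldNormedType.Exports.

Local Open Scope classical_set_scope.
Local Open Scope ring_scope.

Section Hyperbolic.
Variable R : realType.

Definition cosh (x : R) : R := (expR x + expR (- x)) / 2.
Definition sinh (x : R) : R := (expR x - expR (- x)) / 2.
Definition tanh (x : R) : R := sinh x / cosh x.

End Hyperbolic.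

(* The space {+1,-1}^V; [true] encodes +1 and [false] encodes -1 (see [spin]). *)
Definition config (V : finType) : Type := {ffun V -> bool}.

HB.instance Definition _ (V : finType) := Finite.on (config V).
HB.instance Definition _ (V : finType) :=
  isPointed.Build (config V) [ffun=> true].
HB.instance Definition _ (V : finType) :=
  @isMeasurable.Build default_measure_display (config V)
    discrete_measurable discrete_measurable0
    discrete_measurableC discrete_measurableU.

Definition spin {R : realType} {V : finType} (s : config V) (x : V) : R :=
  if s x then 1 else -1.

Definition disagreement (V : finType) (s t : config V) : {set V} :=
  [set x | s x != t x]%SET.

Section SCA.
Variables (R : realType) (V : finType).
Variables (J : V -> V -> R) (h q : V -> R) (beta : R).

Definition hamiltonian (s t : config V) : R :=
  - (2^-1 * \sum_x \sum_y J x y * spin s x * spin t y)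
  - 2^-1 * \sum_x h x * (spin s x + spin t x)
  - 2^-1 * \sum_x q x * spin s x * spin t x.

Definition w_sca (s : config V) : R :=
  \sum_(t : config V) expR (- beta * hamiltonian s t).

Definition P_sca (s t : config V) : R :=
  expR (- beta * hamiltonian s t) / w_sca s.

Definition pi_sca (s : config V) : R :=
  w_sca s / \sum_(t : config V) w_sca t.

(* For beta >= 0 and q >= 0 every term of the maximum is nonnegative, so the
   default value 0 of the iterated maximum is harmless. *)
Definition contraction_rate : R :=
  \big[Num.max/0]_(x : V)
    (tanh (beta * q x / 2) + \sum_(y : V) tanh (beta * `|J x y| / 2)).

End SCA.

Section MixingTime.
Variables (R : realType) (T : finType).

Definition tv_dist (mu nu : T -> R) : R := 2^-1 * \sum_(s : T) `|mu s - nu s|.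

Fixpoint kernel_pow (P : T -> T -> R) (n : nat) (s t : T) : R :=
  if n is m.+1 then \sum_(u : T) P s u * kernel_pow P m u t
  else (s == t)%:R.

(* Valued in the extended reals, so that the infimum over the empty set is
   +oo. *)
Definition mixing_time (P : T -> T -> R) (pi : T -> R) (eps : R) : \bar R :=
  ereal_inf [set (n%:R)%:E | n in
    [set n : nat |
      \big[Num.max/0]_(s : T) tv_dist (kernel_pow P n s) pi <= eps]].

End MixingTime.

Section Transportation.
Variables (R : realType) (V : finType).

Definition is_coupling (mu nu : config V -> R) (d : measure_display)
    (T : measurableType d) (P : probability T R)
    (X Y : {RV P >-> config V}) : Prop :=
  (forall s, distribution P X [set s] = (mu s)%:E) /\
  (forall s, distribution P Y [set s] = (nu s)%:E).

Definition transportation_metric (mu nu : config V -> R) : \bar R :=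
  ereal_inf [set e : \bar R |
    exists (d : measure_display) (T : measurableType d) (P : probability T R)
           (X Y : {RV P >-> config V}),
      is_coupling mu nu X Y /\
      e = expectation P (fun w => #|disagreement (X w) (Y w)|%:R)].

End Transportation.

(* Main.v *)
Require Import Defs.
From HB Require Import structures.
From mathcomp Require Import all_boot all_order all_algebra.
From mathcomp Require Import all_classical all_reals all_analysis.
From mathcomp Require Import measurable_realfun ring lra.

Set Implicit Arguments.
Unset Strict Implicit.
Unset Printing Implicit Defensive.

Import Order.TTheory GRing.Theory Num.Theory.
Local Open Scope ring_scope.

(* Given the configuration s, the new spins are independent, and the spin at x
   is +1 with probability (1 + tanh a_x(s)) / 2, where
   a_x(s) = beta / 2 * (sum_y J x y s_y + h_x + q_x s_x).  Coupling each site
   maximally, the mean number of disagreements is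
   sum_x |tanh a_x(s) - tanh a_x(t)| / 2 <= sum_x tanh (|a_x(s) - a_x(t)| / 2);
   subadditivity of tanh on [0, +oo[ distributes the right-hand side over the
   disagreements of s and t, each contributing at most r.  No path of
   single-site flips from s to t is needed.
   For the mixing time, the coupling shows that the kernel multiplies Lipschitz
   constants (for the Hamming distance) by r, while the total-variation distance
   to the stationary law is attained on a 1-Lipschitz function. *)

(** * Addition formula, subadditivity and Lipschitz-type bounds for the hyperbolic tangent *)

Section Tanh.
Variable R : realType.
Implicit Types x y : R.

Lemma tanhE x : tanh x = (expR x ^+ 2 - 1) / (expR x ^+ 2 + 1).
Proof.
have u0 := expR_gt0 x.
have u2 : 0 < expR x ^+ 2 by rewrite exprn_gt0.
rewrite /tanh /sinh /cosh expRN.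
by field; rewrite !lt0r_neq0 //; lra.
Qed.

Lemma tanh_gtN1 x : -1 < tanh x.
Proof.
have u2 : 0 < expR x ^+ 2 by rewrite exprn_gt0 // expR_gt0.
by rewrite tanhE ltr_pdivlMr; lra.
Qed.

Lemma tanh_lt1 x : tanh x < 1.
Proof.
have u2 : 0 < expR x ^+ 2 by rewrite exprn_gt0 // expR_gt0.
by rewrite tanhE ltr_pdivrMr; lra.
Qed.

Lemma tanh_ge0 x : 0 <= x -> 0 <= tanh x.
Proof.
move=> x0; have u1 : 1 <= expR x by rewrite -expR0 ler_expR.
by rewrite tanhE divr_ge0 //; nra.
Qed.

Lemma tanh0 : tanh (0 : R) = 0.
Proof. by rewrite tanhE expR0 expr1n subrr mul0r. Qed.

Lemma tanhN x : tanh (- x) = - tanh x.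
Proof. by rewrite /tanh /sinh /cosh opprK -mulNr -mulNr opprB [X in _ / (X / _)]addrC. Qed.

(** Both factors lie in the open interval ]-1, 1[; this is the denominator of the addition
    formula. *)
Lemma tanhM_gtN1 x y : 0 < 1 + tanh x * tanh y.
Proof.
have := tanh_gtN1 x; have := tanh_lt1 x.
have := tanh_gtN1 y; have := tanh_lt1 y.
nra.
Qed.

Lemma tanhD x y :
  tanh (x + y) = (tanh x + tanh y) / (1 + tanh x * tanh y).
Proof.
have := lt0r_neq0 (tanhM_gtN1 x y).
have u2 : 0 < expR x ^+ 2 by rewrite exprn_gt0 // expR_gt0.
have v2 : 0 < expR y ^+ 2 by rewrite exprn_gt0 // expR_gt0.
rewrite !tanhE expRD => H.
by field; rewrite !lt0r_neq0 //; nra.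
Qed.

(** On nonnegative arguments the denominator of the addition formula is at least 1. *)
Lemma tanh_ltD x y : 0 <= x -> 0 <= y -> tanh (x + y) <= tanh x + tanh y.
Proof.
move=> /tanh_ge0 x0 /tanh_ge0 y0.
rewrite tanhD ler_pdivrMr ?tanhM_gtN1 //.
have := mulr_ge0 x0 y0; nra.
Qed.

Lemma tanh_sum_le (I : finType) (F : I -> R) : (forall i, 0 <= F i) ->
  tanh (\sum_i F i) <= \sum_i tanh (F i).
Proof.
(* Nonnegativity of the partial sums is carried along, since subadditivity requires it. *)
move=> F0; suff [] : 0 <= \sum_i F i /\ tanh (\sum_i F i) <= \sum_i tanh (F i) by [].
elim/big_ind2 : _ => [|a b c d [a0 ab] [c0 cd]|i _].
- by rewrite tanh0.
- by split; [exact: addr_ge0|exact: le_trans (tanh_ltD a0 c0) (lerD ab cd)].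
- by split.
Qed.

Lemma ler_tanh x y : x <= y -> tanh x <= tanh y.
Proof.
move=> xy; rewrite -[y](subrK x) [y - x + x]addrC tanhD.
rewrite ler_pdivlMr ?tanhM_gtN1 //.
have d0 : 0 <= tanh (y - x) by apply: tanh_ge0; rewrite subr_ge0.
have x2 : tanh x ^+ 2 <= 1.
  by have := tanh_lt1 x; have := tanh_gtN1 x; nra.
have := mulr_ge0 d0 (etrans (subr_ge0 _ _) x2); nra.
Qed.

(** For a fixed gap the increment is largest when the midpoint is 0. With a and b the [tanh] of the
    midpoint and of the half-gap, it equals 2 b (1 - a^2) / (1 - a^2 b^2), and b^2 <= 1. *)
Lemma tanhB_le x y : y <= x -> tanh x - tanh y <= 2 * tanh ((x - y) / 2).
Proof.
move=> yx; set e := (x - y) / 2; pose m := (x + y) / 2.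
have -> : x = m + e by rewrite /m /e; field.
have -> : y = m - e by rewrite /m /e; field.
have e0 : 0 <= tanh e by apply: tanh_ge0; rewrite /e; lra.
have e1 := tanh_lt1 e; have m1 := tanh_lt1 m; have m2 := tanh_gtN1 m.
have Hp := tanhM_gtN1 m e; have Hn := tanhM_gtN1 m (- e).
rewrite !tanhD !tanhN in Hn *.
move: (tanh m) (tanh e) e0 e1 m1 m2 Hp Hn => a b b0 b1 a1 a2 Hp Hn.
have -> : (a + b) / (1 + a * b) - (a + - b) / (1 + a * - b) =
    2 * b * (1 - a ^+ 2) / ((1 + a * b) * (1 + a * - b)).
  by field; rewrite !lt0r_neq0.
rewrite ler_pdivrMr ?mulr_gt0 // -!mulrA ler_wpM2l // ler_wpM2l //.
have a20 : 0 <= a ^+ 2 by exact: sqr_ge0.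
have b21 : b ^+ 2 <= 1 by nra.
nra.
Qed.

Lemma tanh_dist_le x y : `|tanh x - tanh y| <= 2 * tanh (`|x - y| / 2).
Proof.
wlog yx : x y / y <= x.
  by move=> H; case: (leP y x) => [/H//|/ltW/H]; rewrite (distrC y) (distrC (tanh y)).
rewrite [X in tanh (X / _)]ger0_norm ?subr_ge0 //.
rewrite ger0_norm ?tanhB_le //.
by rewrite subr_ge0 ler_tanh.
Qed.

End Tanh.

(** * Product Bernoulli laws and their sitewise maximal coupling *)

Section ProductCoupling.
Variables (R : realType) (V : finType).
Implicit Types (u v : V -> R) (s t : config V).

(** Distributivity: it reduces marginals, normalizations and expectations over configurations to
    single sites. *)
Lemma sum_config_prod (F : V -> bool -> R) :
  \sum_(s : config V) \prod_x F x (s x) = \prod_x (F x true + F x false).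
Proof.
transitivity (\prod_x \sum_b F x b); first exact/esym/bigA_distr_bigA.
by apply: eq_bigr => x _; rewrite big_bool.
Qed.

Lemma card_disagreement s t :
  #|disagreement s t|%:R = \sum_x (s x != t x)%:R :> R.
Proof.
rewrite -sum1_card natr_sum big_mkcond /=.
by apply: eq_bigr => x _; rewrite inE; case: (s x != t x).
Qed.

Definition bernoulli_prod u s : R := \prod_x (if s x then u x else 1 - u x).

(* The maximal coupling of the Bernoulli laws of parameters [p] and [p']. *)
Definition bernoulli_coupling (p p' : R) (a b : bool) : R :=
  if a then (if b then Num.min p p' else p - Num.min p p')
  else (if b then p' - Num.min p p' else 1 - Num.max p p').

Definition prod_coupling u v s t : R :=
  \prod_x bernoulli_coupling (u x) (v x) (s x) (t x).

Lemma prod_couplingC u v s t : prod_coupling u v s t = prod_coupling v u t s.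
Proof.
apply: eq_bigr => x _; rewrite /bernoulli_coupling minC maxC.
by case: (s x); case: (t x).
Qed.

Lemma sum_prod_coupling u v s :
  \sum_(t : config V) prod_coupling u v s t = bernoulli_prod u s.
Proof.
rewrite (sum_config_prod (fun x => bernoulli_coupling (u x) (v x) (s x))).
apply: eq_bigr => x _; rewrite /bernoulli_coupling.
by case: (s x); case: leP => ?; ring.
Qed.

Lemma sum_bernoulli_prod u : \sum_s bernoulli_prod u s = 1.
Proof.
rewrite (sum_config_prod (fun x b => if b then u x else 1 - u x)).
by rewrite big1 // => x _; rewrite addrC subrK.
Qed.

Lemma prod_coupling_ge0 u v s t :
    (forall x, 0 <= u x <= 1) -> (forall x, 0 <= v x <= 1) ->
  0 <= prod_coupling u v s t.
Proof.
move=> u01 v01; apply: prodr_ge0 => x _; rewrite /bernoulli_coupling.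
have /andP[u0 u1] := u01 x; have /andP[v0 v1] := v01 x.
by case: (s x); case: (t x); case: (leP (u x)) => ?; lra.
Qed.

Lemma prod_coupling_disagreement u v :
  \sum_s \sum_t prod_coupling u v s t * #|disagreement s t|%:R =
  \sum_x `|u x - v x|.
Proof.
under eq_bigr do under eq_bigr do rewrite card_disagreement mulr_sumr.
under eq_bigr do rewrite exchange_big /=.
rewrite exchange_big /=; apply: eq_bigr => x _.
(* The indicator of a disagreement at [x] is absorbed into the factor at [x]. The other factors then
   sum to 1, and that one to p + p' - 2 min(p, p') = |p - p'|. *)
pose G z a b : R := bernoulli_coupling (u z) (v z) a b *
  (if z == x then (a != b)%:R else 1).
transitivity (\sum_(s : config V) \sum_(t : config V) \prod_z G z (s z) (t z)).
  apply: eq_bigr => s _; apply: eq_bigr => t _.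
  by rewrite big_split /= -big_mkcond big_pred1_eq.
under eq_bigr do rewrite (sum_config_prod (fun z => G z _)).
rewrite (sum_config_prod (fun z a => G z a true + G z a false)).
rewrite (bigD1 x) //= big1 => [|z /negPf zx].
  rewrite /G /bernoulli_coupling eqxx /= mulr1.
  case: leP => uv; [rewrite ler0_norm|rewrite gtr0_norm]; lra.
by rewrite /G /bernoulli_coupling zx; case: leP => ?; ring.
Qed.

End ProductCoupling.

(** * Product form, stationarity and one-step contraction of the SCA kernel *)

Section SCAContraction.
Variables (R : realType) (V : finType).
Variables (J : V -> V -> R) (h q : V -> R) (beta : R).
Hypothesis J_sym : forall x y, J x y = J y x.
Implicit Types s t : config V.

Definition local_field s x : R :=
  beta / 2 * (\sum_y J x y * spin s y + h x + q x * spin s x).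

Definition up_prob s x : R := (1 + tanh (local_field s x)) / 2.

Lemma up_prob_itv s x : 0 <= up_prob s x <= 1.
Proof.
rewrite /up_prob; have := tanh_gtN1 (local_field s x).
by have := tanh_lt1 (local_field s x); lra.
Qed.

Lemma hamiltonian_sym s t : hamiltonian J h q s t = hamiltonian J h q t s.
Proof.
rewrite /hamiltonian; congr (- (_ * _) - _ * _ - _ * _).
- rewrite exchange_big; apply: eq_bigr => x _; apply: eq_bigr => y _.
  by rewrite J_sym mulrAC.
- by apply: eq_bigr => x _; rewrite addrC.
- by apply: eq_bigr => x _; rewrite mulrAC.
Qed.

(** Separates a term depending on [s] alone, which cancels in the normalization, from one that is
    linear in the spins of [t] and hence factorizes over sites. *)
Lemma hamiltonianE s t : - beta * hamiltonian J h q s t =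
  beta / 2 * (\sum_x h x * spin s x) + \sum_x local_field s x * spin t x.
Proof.
have -> : \sum_x local_field s x * spin t x =
    beta / 2 * (\sum_x \sum_y J x y * spin s x * spin t y +
      \sum_x h x * spin t x + \sum_x q x * spin s x * spin t x).
  rewrite exchange_big -!big_split mulr_sumr; apply: eq_bigr => x _ /=.
  rewrite /local_field -mulrA; congr (_ * _).
  rewrite !mulrDl mulr_suml; congr (_ + _ + _).
  by apply: eq_bigr => y _; rewrite J_sym.
rewrite /hamiltonian.
under [X in - beta * (_ - _ * X - _)]eq_bigr do rewrite mulrDr.
by rewrite big_split /=; field.
Qed.

Lemma w_sca_gt0 s : 0 < w_sca J h q beta s.
Proof.
by rewrite /w_sca (bigD1 s) //= ltr_wpDr ?expR_gt0 // sumr_ge0.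
Qed.

Lemma P_scaE s t : P_sca J h q beta s t = bernoulli_prod (up_prob s) t.
Proof.
have eE t' : expR (- beta * hamiltonian J h q s t') =
    expR (beta / 2 * (\sum_x h x * spin s x)) *
    \prod_x expR (local_field s x * (if t' x then 1 else -1)).
  by rewrite hamiltonianE expRD expR_sum.
rewrite /P_sca /w_sca; under eq_bigr do rewrite eE.
rewrite eE -mulr_sumr.
rewrite (sum_config_prod (fun x b => expR (local_field s x * (if b then 1 else -1)))).
(* The prefactor depending on [s] cancels; what is left at each site is e^(+-a) / (e^a + e^(-a)) =
   (1 +- tanh a) / 2. *)
rewrite -mulf_div divff ?mul1r ?lt0r_neq0 ?expR_gt0 // -prodf_div.
apply: eq_bigr => x _; rewrite /up_prob tanhE mulr1 mulrN1 expRN.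
have u0 := expR_gt0 (local_field s x).
have u2 : 0 < expR (local_field s x) ^+ 2 by rewrite exprn_gt0.
by case: (t x); rewrite ?mulr1 ?mulrN1 ?expRN; field; rewrite !lt0r_neq0 //; lra.
Qed.

(** Detailed balance: [pi_sca s * P_sca s t] is the Boltzmann weight of the pair over the partition
    function, which is symmetric in [s] and [t]. *)
Lemma P_sca_stationary t :
  \sum_s pi_sca J h q beta s * P_sca J h q beta s t = pi_sca J h q beta t.
Proof.
rewrite /pi_sca /P_sca [X in _ = X / _]/w_sca mulr_suml; apply: eq_bigr => s _.
rewrite (hamiltonian_sym t) mulf_div (mulrC _ (w_sca J h q beta s)) -mulf_div.
by rewrite divff ?mul1r // lt0r_neq0 ?w_sca_gt0.
Qed.

Lemma pi_sca_ge0 s : 0 <= pi_sca J h q beta s.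
Proof.
have w0 t : 0 <= w_sca J h q beta t by exact/ltW/w_sca_gt0.
by rewrite divr_ge0 // sumr_ge0.
Qed.

Lemma sum_pi_sca : \sum_s pi_sca J h q beta s = 1.
Proof.
rewrite -mulr_suml divff // lt0r_neq0 //.
rewrite (bigD1 [ffun=> true]) //= ltr_wpDr ?w_sca_gt0 //.
by apply: sumr_ge0 => t _; exact/ltW/w_sca_gt0.
Qed.

Hypotheses (q_ge0 : forall x, 0 <= q x) (beta_ge0 : 0 <= beta).

Lemma le_contraction_rate x :
  tanh (beta * q x / 2) + \sum_y tanh (beta * `|J x y| / 2)
    <= contraction_rate J q beta.
Proof. exact: le_bigmax. Qed.

Lemma normr_spinB s t x :
  `|spin s x - spin t x| = 2 * (s x != t x)%:R :> R.
Proof.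
rewrite /spin; case: (s x); case: (t x); rewrite ?subrr ?normr0 /= ?mulr0 //.
- by rewrite opprK ger0_norm //; ring.
- by rewrite ler0_norm; lra.
Qed.

Lemma up_prob_dist s t x : `|up_prob s x - up_prob t x| <=
  tanh (beta * q x / 2) * (s x != t x)%:R +
  \sum_y tanh (beta * `|J x y| / 2) * (s y != t y)%:R.
Proof.
(* As tanh 0 = 0, the disagreement indicators can be moved inside [tanh], where subadditivity
   applies. *)
have tanhMb (c : R) (b : bool) : tanh c * b%:R = tanh (c * b%:R).
  by case: b; rewrite ?mulr1 // !mulr0 tanh0.
have b20 : 0 <= beta / 2 by rewrite divr_ge0.
rewrite tanhMb; under eq_bigr do rewrite tanhMb.
pose a := beta * q x / 2 * (s x != t x)%:R.
pose b y := beta * `|J x y| / 2 * (s y != t y)%:R.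
have a0 : 0 <= a by rewrite !mulr_ge0.
have b0 y : 0 <= b y by rewrite !mulr_ge0.
have -> : up_prob s x - up_prob t x =
    (tanh (local_field s x) - tanh (local_field t x)) / 2.
  by rewrite /up_prob; field.
rewrite normrM [`|2^-1|]ger0_norm // ler_pdivrMr //.
apply: le_trans (tanh_dist_le _ _) _; rewrite mulrC ler_pM2r //.
apply: (@le_trans _ _ (tanh (a + \sum_y b y))); last first.
  apply: le_trans (tanh_ltD a0 (sumr_ge0 _ _)) _ => //.
  by rewrite lerD2l tanh_sum_le.
(* The external field cancels in the difference of local fields. Each disagreeing spin changes by 2,
   which offsets the remaining factor 1/2. *)
apply: ler_tanh; rewrite ler_pdivrMr //.
have -> : local_field s x - local_field t x =
   beta / 2 * (q x * (spin s x - spin t x) +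
     \sum_y J x y * (spin s y - spin t y)).
  under [X in _ = _ * (_ + X)]eq_bigr do rewrite mulrBr.
  by rewrite sumrB /local_field; ring.
rewrite normrM ger0_norm //.
have -> : (a + \sum_y b y) * 2 = beta / 2 *
    (q x * (2 * (s x != t x)%:R) + \sum_y `|J x y| * (2 * (s y != t y)%:R)).
  rewrite mulrDl [RHS]mulrDr [in LHS]mulr_suml [in RHS]mulr_sumr /a; congr (_ + _); first by field.
  by apply: eq_bigr => y _; rewrite /b; field.
apply: ler_wpM2l => //; apply: le_trans (ler_normD _ _) _; apply: lerD.
  by rewrite normrM normr_spinB ger0_norm.
apply: le_trans (ler_norm_sum _ _ _) _; apply: ler_sum => y _.
by rewrite normrM normr_spinB.
Qed.

(** Exchanging the sums, each disagreeing site collects its own pinning term and a column sum of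
    [J]; by symmetry of [J] this is the row sum bounded by [contraction_rate]. *)
Lemma sum_up_prob_dist s t :
  \sum_x `|up_prob s x - up_prob t x| <=
  contraction_rate J q beta * #|disagreement s t|%:R.
Proof.
apply: le_trans (ler_sum _ (fun x _ => up_prob_dist s t x)) _.
rewrite big_split /= exchange_big -big_split /= card_disagreement mulr_sumr.
apply: ler_sum => x _; rewrite -mulr_suml -mulrDl ler_wpM2r //.
under eq_bigr do rewrite J_sym; exact: le_contraction_rate.
Qed.

End SCAContraction.

(** * From coupling matrices to couplings by random variables *)

Definition finite_coupling (R : realType) (T : finType) (mu nu : T -> R)
    (K : T -> T -> R) : Prop :=
  [/\ forall s t, 0 <= K s t, forall s, \sum_t K s t = mu s
    & forall t, \sum_s K s t = nu t].

Lemma prod_coupling_finite_coupling (R : realType) (V : finType) (u v : V -> R) :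
    (forall x, 0 <= u x <= 1) -> (forall x, 0 <= v x <= 1) ->
  finite_coupling (bernoulli_prod u) (bernoulli_prod v) (prod_coupling u v).
Proof.
move=> u01 v01; split=> [s t|s|t]; first exact: prod_coupling_ge0.
  exact: sum_prod_coupling.
by under eq_bigr do rewrite prod_couplingC; exact: sum_prod_coupling.
Qed.

Section JointLaw.
Local Open Scope classical_set_scope.
Local Open Scope ereal_scope.
Variables (R : realType) (V : finType) (K : config V -> config V -> R).
Hypothesis K_ge0 : forall s t, (0 <= K s t)%R.
Hypothesis K_sum : (\sum_s \sum_t K s t = 1)%R.

Local Notation pair := (config V * config V)%type.
(** [msum] is indexed by naturals, so pairs are enumerated; the default [point] lies beyond the
    range of summation. *)
Let pt k : pair := nth point (enum {: pair}) k.
Let atom k : {measure set pair -> \bar R} :=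
  mscale (NngNum (K_ge0 (pt k).1 (pt k).2)) (dirac (pt k)).

Definition joint_law : set pair -> \bar R := msum atom (size (enum {: pair})).

Let sum_pt (F : pair -> \bar R) :
  \sum_(k < size (enum {: pair})) F (pt k) = \sum_s \sum_t F (s, t).
Proof.
rewrite pair_big /= -(big_mkord xpredT (F \o pt)) /=.
rewrite -(big_nth point xpredT F) big_enum /=.
by apply: eq_bigr => -[].
Qed.

Lemma joint_lawE A :
  joint_law A = \sum_s \sum_t (K s t)%:E * \d_((s, t) : pair) A.
Proof. by rewrite -(sum_pt (fun p => (K p.1 p.2)%:E * \d_p A)). Qed.

Let joint_lawT : joint_law setT = 1.
Proof.
rewrite joint_lawE -K_sum -sumEFin; apply: eq_bigr => s _.
by rewrite -sumEFin; apply: eq_bigr => t _; rewrite diracT mule1.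
Qed.

HB.instance Definition _ := Measure.on joint_law.
HB.instance Definition _ := Measure_isProbability.Build _ _ _ joint_law joint_lawT.

(** The product sigma-algebra is discrete: singletons are measurable rectangles, and every set of
    pairs is countable. *)
Lemma measurable_fun_config_pair d (U : sigmaRingType d) (f : pair -> U) :
  measurable_fun [set: pair] f.
Proof.
move=> _ B mB; rewrite setTI; apply: countable_measurable => [[s t]|].
  rewrite (_ : [set (s, t)] = [set s] `*` [set t]); first exact: measurableX.
  by apply/seteqP; split=> -[a b] /= [-> ->].
exact: countableP.
Qed.

Lemma expectation_joint_law (f : pair -> R) : (forall p, (0 <= f p)%R) ->
  expectation joint_law f = (\sum_s \sum_t K s t * f (s, t))%:E.
Proof.
move=> f0; rewrite unlock.
have mf := @measurable_fun_config_pair _ (\bar R) (EFin \o f).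
rewrite ge0_integral_measure_sum //; last by move=> x _; rewrite lee_fin.
transitivity (\sum_(k < size (enum {: pair})) (K (pt k).1 (pt k).2 * f (pt k))%:E).
  apply: eq_bigr => k _; rewrite ge0_integral_mscale //; last first.
    by move=> x _; rewrite lee_fin.
  by rewrite integral_dirac // diracT mul1e.
rewrite (sum_pt (fun p => (K p.1 p.2 * f p)%:E)) /= -sumEFin.
by apply: eq_bigr => s _; rewrite sumEFin.
Qed.

Let fst_mfun : {mfun pair >-> config V} :=
  HB.pack (fst : pair -> config V)
    (isMeasurableFun.Build _ _ _ _ (fst : pair -> config V)
       (measurable_fun_config_pair _)).
Let snd_mfun : {mfun pair >-> config V} :=
  HB.pack (snd : pair -> config V)
    (isMeasurableFun.Build _ _ _ _ (snd : pair -> config V)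
       (measurable_fun_config_pair _)).

Lemma transportation_metric_le_joint (mu nu : config V -> R) :
    finite_coupling mu nu K ->
  transportation_metric mu nu <=
  (\sum_s \sum_t K s t * #|disagreement s t|%:R)%:E.
Proof.
move=> [_ Kmu Knu]; apply: ereal_inf_lbound.
(* The probability space is the set of pairs itself, with the two projections as random
   variables. *)
exists _, _, joint_law, fst_mfun, snd_mfun; split; last first.
  by rewrite expectation_joint_law.
split=> s; rewrite -[LHS]/(joint_law _) joint_lawE.
(* Only the atoms with first coordinate [s] charge the preimage; their weights form a row sum of
   [K]. *)
- rewrite (bigD1 s) //= [X in _ + X]big1 ?adde0 => [|s' s's].
    rewrite -Kmu -sumEFin; apply: eq_bigr => t _.
    by rewrite diracE mem_set ?mule1.
  by apply: big1 => t _; rewrite diracE memNset ?mule0 //=; apply/eqP.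
- rewrite exchange_big (bigD1 s) //= [X in _ + X]big1 ?adde0 => [|s' s's].
    rewrite -Knu -sumEFin; apply: eq_bigr => t _.
    by rewrite diracE mem_set ?mule1.
  by apply: big1 => t _; rewrite diracE memNset ?mule0 //=; apply/eqP.
Qed.

End JointLaw.

Lemma transportation_metric_le (R : realType) (V : finType)
    (mu nu : config V -> R) (K : config V -> config V -> R) :
    \sum_s mu s = 1 -> finite_coupling mu nu K ->
  (transportation_metric mu nu <=
  (\sum_s \sum_t K s t * #|disagreement s t|%:R)%:E)%E.
Proof.
move=> mu1 KP; have [K0 Kmu _] := KP.
apply: (transportation_metric_le_joint K0) => //.
by under eq_bigr do rewrite Kmu.
Qed.

(** * Mixing time of a kernel that contracts the transportation metric *)

Section Mixing.
Variables (R : realType) (V : finType).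
Variables (P : config V -> config V -> R) (pi : config V -> R) (r : R).
Implicit Types (s t : config V) (f : config V -> R).

Hypothesis r_ge0 : 0 <= r.
Hypothesis P_contracting : forall s t, exists2 K,
  finite_coupling (P s) (P t) K
  & \sum_u \sum_v K u v * #|disagreement u v|%:R <= r * #|disagreement s t|%:R.
Hypothesis pi_ge0 : forall s, 0 <= pi s.
Hypothesis pi_sum : \sum_s pi s = 1.
Hypothesis pi_stationary : forall t, \sum_s pi s * P s t = pi t.

Definition lipschitz_config (L : R) f : Prop :=
  forall s t, `|f s - f t| <= L * #|disagreement s t|%:R.

(** The difference of the two averages is the mean of [f u - f v] under the coupling [K], hence at
    most [L] times the mean number of disagreements. *)
Lemma lipschitz_config_kernel L f : 0 <= L -> lipschitz_config L f ->
  lipschitz_config (r * L) (fun s => \sum_u P s u * f u).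
Proof.
move=> L0 fL s t; have [K [K0 Ks Kt] Kr] := P_contracting s t.
have -> : \sum_u P s u * f u - \sum_u P t u * f u =
    \sum_u \sum_v K u v * (f u - f v).
  under [RHS]eq_bigr do
    (under eq_bigr do rewrite mulrBr; rewrite sumrB -mulr_suml Ks).
  rewrite sumrB; congr (_ - _); rewrite exchange_big /=.
  by apply: eq_bigr => u _; rewrite -mulr_suml Kt.
rewrite [r * L]mulrC -mulrA.
apply: le_trans (ler_wpM2l L0 Kr); rewrite mulr_sumr.
apply: le_trans (ler_norm_sum _ _ _) _; apply: ler_sum => u _; rewrite mulr_sumr.
apply: le_trans (ler_norm_sum _ _ _) _; apply: ler_sum => v _.
by rewrite normrM ger0_norm // mulrCA ler_wpM2l.
Qed.

Lemma kernel_powS_apply n s f :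
  \sum_u kernel_pow P n.+1 s u * f u =
  \sum_v P s v * \sum_u kernel_pow P n v u * f u.
Proof.
rewrite /=; under eq_bigr do rewrite mulr_suml.
rewrite exchange_big; apply: eq_bigr => v _; rewrite mulr_sumr.
by apply: eq_bigr => u _; rewrite mulrA.
Qed.

Lemma kernel_pow0_apply s f : \sum_u kernel_pow P 0 s u * f u = f s.
Proof.
rewrite (bigD1 s) //= eqxx mul1r big1 ?addr0 // => t.
by rewrite eq_sym => /negPf ->; rewrite mul0r.
Qed.

Lemma lipschitz_config_kernel_pow n L f : 0 <= L -> lipschitz_config L f ->
  lipschitz_config (r ^+ n * L) (fun s => \sum_u kernel_pow P n s u * f u).
Proof.
move=> L0 fL; elim: n => [|n IH] s t.
  by rewrite !kernel_pow0_apply expr0 mul1r.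
rewrite !kernel_powS_apply exprS -(mulrA r).
have rL0 : 0 <= r ^+ n * L by rewrite mulr_ge0 ?exprn_ge0.
exact: (lipschitz_config_kernel rL0 IH).
Qed.

Lemma kernel_pow_stationary n f :
  \sum_s pi s * (\sum_u kernel_pow P n s u * f u) = \sum_s pi s * f s.
Proof.
elim: n => [|n IH]; first by under eq_bigr do rewrite kernel_pow0_apply.
under eq_bigr do rewrite kernel_powS_apply mulr_sumr.
rewrite exchange_big -IH; apply: eq_bigr => v _ /=.
by under eq_bigr do rewrite mulrA; rewrite -mulr_suml pi_stationary.
Qed.

(* The half-sign [f] of [P^n(s, .) - pi] is 1-Lipschitz and integrates that
   difference to the total-variation distance. *)
Lemma tv_dist_kernel_pow_le n s :
  tv_dist (kernel_pow P n s) pi <= r ^+ n * #|V|%:R.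
Proof.
pose f u : R := Num.sg (kernel_pow P n s u - pi u) / 2.
have f1 : lipschitz_config 1 f.
  move=> u v; rewrite mul1r; have [->|uv] := eqVneq u v.
    by rewrite subrr normr0 ler0n.
  (* Values of [f] are at most 1/2 in modulus, and distinct configurations disagree at one site or
     more. *)
  apply: (@le_trans _ _ 1).
    have f_le w : `|f w| <= 2^-1.
      by rewrite normrM [`|2^-1|]ger0_norm // normr_sg ler_piMl //; case: (_ != 0).
    rewrite (le_trans (ler_normB _ _)) //.
    by have := lerD (f_le u) (f_le v); lra.
  rewrite -[1]/(1%:R) ler_nat card_gt0; apply: contraNneq uv => D0.
  apply/eqP/ffunP => x; have : x \notin disagreement u v by rewrite D0 finset.in_set0.
  by rewrite inE negbK => /eqP.
(* By stationarity the mean of [f] under [pi] is also that of its image under the n-th power of the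
   kernel, so only differences between two starting points remain; two configurations are at
   distance at most |V|. *)
have -> : tv_dist (kernel_pow P n s) pi =
    \sum_t pi t * (\sum_u kernel_pow P n s u * f u - \sum_u kernel_pow P n t u * f u).
  under [RHS]eq_bigr do rewrite mulrBr.
  rewrite sumrB -mulr_suml pi_sum mul1r kernel_pow_stationary -sumrB.
  rewrite /tv_dist mulr_sumr; apply: eq_bigr => u _.
  by rewrite -mulrBl /f mulrA [RHS]mulrC normrEsg [Num.sg _ * _]mulrC.
rewrite -[leRHS]mul1r -[X in _ <= X * _]pi_sum mulr_suml; apply: ler_sum => t _.
rewrite ler_wpM2l //; apply: le_trans (ler_norm _) _.
have lip := lipschitz_config_kernel_pow n ler01 f1 s t.
by rewrite (le_trans lip) // mulr1 ler_wpM2l ?exprn_ge0 // ler_nat max_card.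
Qed.

Lemma mixing_time_le (eps : R) : (0 < #|V|)%N -> 0 < r -> r < 1 -> 0 < eps -> eps <= 1 ->
  (mixing_time P pi eps
    <= ((Num.ceil ((ln (#|V|%:R) - ln eps) / ln (1 / r)))%:~R)%:E)%E.
Proof.
move=> V0 r0 r1 eps0 eps1; set a := (_ - _) / _.
have lnr : 0 < ln (1 / r) by rewrite ln_gt0 // ltr_pdivlMr ?mul1r.
have V1 : (0 : R) < #|V|%:R by rewrite ltr0n.
have a0 : 0 <= a.
  rewrite divr_ge0 ?(ltW lnr) // subr_ge0 (le_trans (ln_le0 eps1)) //.
  by rewrite ln_ge0 // ler1n.
(* Nonnegativity, due to eps <= 1 <= |V|, makes the integer ceiling a legitimate number of steps. *)
have : 0 <= Num.ceil a by rewrite ceil_ge0; apply: lt_le_trans a0; rewrite ltrN10.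
move=> /gez0_abs; set n := absz _ => nE; apply: ereal_inf_lbound.
exists n; last by rewrite -nE.
(* The default value 0 of the maximum must also be at most [eps]. *)
apply: bigmax_le => [|s _]; first exact: ltW.
apply: le_trans (tv_dist_kernel_pow_le n s) _.
have an : a <= n%:R by rewrite (le_trans (ceil_ge a)) // -nE.
(* Taking logarithms, r^n |V| <= eps becomes n ln(1/r) >= ln |V| - ln eps, that is, n >= a. *)
rewrite -ler_ln ?posrE ?mulr_gt0 ?exprn_gt0 // lnM ?posrE ?exprn_gt0 // lnXn //.
move: an; rewrite /a ler_pdivrMr // div1r lnV ?posrE // mulrN -mulr_natl.
lra.
Qed.

End Mixing.

(** * Contraction and mixing of the SCA *)

Theorem theorem2p2 (R : realType) (V : finType) (edge : rel V)
    (J : V -> V -> R) (h q : V -> R) (beta : R)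
    (V_nonempty : (0 < #|V|)%N)
    (edge_sym : symmetric edge) (edge_irr : irreflexive edge)
    (J_sym : forall x y, J x y = J y x)
    (J_edge : forall x y, ~~ edge x y -> J x y = 0)
    (q_ge0 : forall x, 0 <= q x) (beta_ge0 : 0 <= beta) :
  let r := contraction_rate J q beta in
  let P := P_sca J h q beta in
  let pi := pi_sca J h q beta in
  r < 1 ->
  (forall s t : config V,
     (transportation_metric (P s) (P t)
       <= (r * #|disagreement s t|%:R)%:E)%E) /\
  (0 < r ->
   forall eps : R, 0 < eps -> eps <= 1 ->
     (mixing_time P pi eps
       <= ((Num.ceil ((ln (#|V|%:R) - ln eps) / ln (1 / r)))%:~R)%:E)%E).
Proof.
move=> r P pi r_lt1.
pose u s := up_prob J h q beta s.
have PE s : P s = bernoulli_prod (u s) by apply/funext => t; exact: P_scaE.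
(* A single coupling matrix serves both the transportation bound and the mixing bound. *)
have P_contracting s t : exists2 K, finite_coupling (P s) (P t) K
    & \sum_a \sum_b K a b * #|disagreement a b|%:R
      <= r * #|disagreement s t|%:R.
  exists (prod_coupling (u s) (u t)).
    by rewrite !PE; apply: prod_coupling_finite_coupling => x; exact: up_prob_itv.
  by rewrite prod_coupling_disagreement sum_up_prob_dist.
split=> [s t|r_gt0 eps eps_gt0 eps_le1].
  have [K Kst Kr] := P_contracting s t.
  apply: (le_trans (transportation_metric_le _ Kst)); last by rewrite lee_fin.
  by rewrite PE sum_bernoulli_prod.
apply: mixing_time_le => //; first exact: ltW.
- exact: pi_sca_ge0.
- exact: sum_pi_sca.
- exact: P_sca_stationary.
Qed.
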